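(* Suppose that $T:C(\mathbb{N}^* )\rightarrow C(\mathbb{N}^* )$ is a funnelless automorphism. Then $T$ is right-locally canonizable along a quasi-open map; that is, for every infinite $A\subseteq\mathbb{N}$ there are an infinite $A_1\subseteq A$, an infinite $B\subseteq\mathbb{N}$ and a quasi-open map $\psi:B^*\to A_1^*$ such that $T_{B,A_1}$ is canonizable along $\psi$.
   Context: $\mathbb{N}^*=\beta\mathbb{N}\setminus\mathbb{N}$; for $A\subseteq\mathbb{N}$, $A^*=\overline{A}^{\beta\mathbb{N}}\setminus A$ is the corresponding clopen subset of $\mathbb{N}^*$. An automorphism is a bounded linear bijection with bounded inverse. The dual of $C(\mathbb{N}^* )$ is identified with the space of Radon measures on $\mathbb{N}^*$, $T^\star$ is the adjoint of $T$, and $\delta_y$ is the Dirac measure at $y$. $T$ is funnelless if for every nowhere dense $F\subseteq\mathbb{N}^*$ there is a nowhere dense $G\subseteq\mathbb{N}^*$ such that for all $y\in F$ the measure $T^\star(\delta_y)$ is concentrated on $G$, i.e. $|T^\star(\delta_y)|(\mathbb{N}^*\setminus G)=0$ (one may always take $G$ closed). For infinite $A,B\subseteq\mathbb{N}$, $P_B:C(\mathbb{N}^* )\to C(B^* )$ is restriction to $B^*$, $I_A:C(A^* )\to C(\mathbb{N}^* )$ is extension by zero, and $T_{B,A}=P_B\circ T\circ I_A$. A continuous map is quasi-open if the image of every nonempty open set has nonempty interior. $T_{B,A}$ is canonizable along $\psi:B^*\to A^*$ if $\psi$ is a continuous surjection and there is a nonzero real $r$ with $T_{B,A}(f)=r f\circ\psi$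 for all $f\in C(A^* )$. *)

(* Defs.v *)
From HB Require Import structures.
From mathcomp Require Import all_boot all_order all_algebra.
From mathcomp Require Import all_classical all_reals all_analysis.

Set Implicit Arguments.
Unset Strict Implicit.
Unset Printing Implicit Defensive.

Import Order.TTheory GRing.Theory Num.Theory.
Import numFieldNormedType.Exports.

Local Open Scope classical_set_scope.
Local Open Scope ring_scope.

(* The Cech-Stone compactification of the discrete space nat, realized as the
   space of ultrafilters on nat; the sets {p | A \in p}, A : set nat, form a
   base of open sets. *)
Record betaN := BetaN {
  betaN_sets :> set_system nat;
  betaN_ultra : UltraFilter betaN_sets
}.

#[export] Existing Instance betaN_ultra.

HB.instance Definition _ := gen_eqMixin betaN.
HB.instance Definition _ := gen_choiceMixin betaN.

Definition betaN_base (A : set nat) : set betaN := [set p | betaN_sets p A].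

Lemma betaN_base_cover : \bigcup_(A in [set: set nat]) betaN_base A = setT.
Proof.
apply/seteqP; split=> // p _; exists setT => //.
exact: (@filterT _ (betaN_sets p)).
Qed.

Lemma betaN_base_join (A B : set nat) (p : betaN) :
  [set: set nat] A -> [set: set nat] B -> betaN_base A p -> betaN_base B p ->
  exists C, [/\ [set: set nat] C, betaN_base C p &
    betaN_base C `<=` betaN_base A `&` betaN_base B].
Proof.
move=> _ _ pA pB; exists (A `&` B); split=> //; first exact: (@filterI _ (betaN_sets p)).
by move=> q qAB; split; apply: (@filterS _ (betaN_sets q)) qAB => x [].
Qed.

HB.instance Definition _ :=
  isBaseTopological.Build betaN betaN_base_cover betaN_base_join.

Definition principal (n : nat) : betaN := BetaN (principal_filter_ultra n).

Definition remainder : set betaN := ~` range principal.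

Lemma remainder_nonempty : remainder !=set0.
Proof.
have [p [Up sp]] := @ultraFilterLemma nat \oo _.
exists (BetaN Up) => -[n _ En].
have : p [set m | (n < m)%N] by apply: sp; exists n.+1.
by rewrite -[p]/(betaN_sets (BetaN Up)) -En => /principal_filterP; rewrite /= ltnn.
Qed.

Definition Nstar : Type := set_type remainder.

HB.instance Definition _ := Topological.on Nstar.
Definition Nstar_point : Nstar :=
  exist _ (sval (cid remainder_nonempty))
    (mem_set (svalP (cid remainder_nonempty))).

HB.instance Definition _ := isPointed.Build Nstar Nstar_point.

(* A^*, as a subset of the type Nstar *)
Definition star (A : set nat) : set Nstar :=
  set_val @^-1` (closure (principal @` A) `\` principal @` A).

Lemma betaN_meet (p : betaN) (A B : set nat) :
  betaN_sets p A -> betaN_sets p B -> A `&` B !=set0.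
Proof.
by move=> pA pB; apply: (@filter_ex _ (betaN_sets p)); exact: filterI.
Qed.

Lemma starP (A : set nat) (x : Nstar) : star A x <-> betaN_sets (set_val x) A.
Proof.
have Ux := betaN_ultra (set_val x).
split=> [[cA _]|xA].
  have [//|xnA] := in_ultra_setVsetC A Ux.
  have : nbhs (set_val x) (betaN_base (~` A)).
    apply: open_nbhs_nbhs; split=> //.
    exists [set ~` A] => //; exact: bigcup_set1.
  by move=> /cA[_ [[n An <-]]] /principal_filterP.
split.
  move=> U; rewrite nbhsE => -[V [[D _ <-] [B DB xB]] VU].
  have [n [An Bn]] := betaN_meet xA xB.
  exists (principal n); split; first by exists n.
  by apply: VU; exists B => //; exact/principal_filterP.
by case=> n _ nx; have /set_mem := valP x; apply; exists n.
Qed.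

Lemma star_clopen (A : set nat) : clopen (star A).
Proof.
have oS B : open (star B).
  exists (betaN_base B); first by exists [set B] => //; exact: bigcup_set1.
  by apply/seteqP; split=> x /starP.
split=> //; rewrite -openC (_ : ~` star A = star (~` A)); first exact: oS.
apply/seteqP; split=> x.
  move=> nA; apply/starP.
  by have [/starP|] := in_ultra_setVsetC A (betaN_ultra (set_val x)).
by move=> /starP xnA /starP xA; have [n []] := betaN_meet xA xnA.
Qed.

Section topological_notions.
Context {X Y : topologicalType}.

Definition nowhere_dense (F : set X) := interior (closure F) = set0.

Definition quasi_open (f : X -> Y) :=
  continuous f /\
  forall U : set X, open U -> U !=set0 -> interior (f @` U) !=set0.

End topological_notions.

(* The vector space of real-valued continuous functions on X *)
Definition cspace (R : realType) (X : topologicalType) : Type :=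
  continuousType X R.

Section cspace_lmodType.
Context {R : realType} {X : topologicalType}.

HB.instance Definition _ := Choice.on (cspace R X).

Definition cpred : {pred X -> R} := mem [set f | continuous f].

Definition cspace_Sub (f : X -> R) (fP : f \in cpred) : cspace R X :=
  mkcts (set_mem fP).

Lemma cspace_rect (K : cspace R X -> Type) :
  (forall f (fP : f \in cpred), K (cspace_Sub fP)) -> forall u, K u.
Proof.
move=> Ksub [f [[fc]]].
by have := Ksub f (mem_set fc); congr (K _); exact/continuousEP.
Qed.

Lemma cspace_valP (f : X -> R) (fP : f \in cpred) :
  cspace_Sub fP = f :> (X -> R).
Proof. by []. Qed.

HB.instance Definition _ := isSub.Build _ _ (cspace R X)
  cspace_rect cspace_valP.

Lemma cpred_submod_closed : submod_closed cpred.
Proof.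
split=> [|a f g /set_mem fc /set_mem gc]; apply: mem_set.
  by move=> x; exact: cvg_cst.
by move=> x; apply: cvgD; [apply: cvgZr; exact: fc|exact: gc].
Qed.

HB.instance Definition _ :=
  GRing.isSubmodClosed.Build _ _ cpred cpred_submod_closed.
HB.instance Definition _ :=
  [SubChoice_isSubLmodule of cspace R X by <:].

End cspace_lmodType.

(* sup is the least upper bound only for bounded f; this covers all of
   cspace R X when X is compact, as Nstar and star A are. *)
Definition sup_norm (R : realType) (X : topologicalType) (f : cspace R X) : R :=
  sup [set `|f x| | x in [set: X]].

Definition bounded_operator (R : realType) (X Y : topologicalType)
    (T : cspace R X -> cspace R Y) :=
  exists M : R, forall f, sup_norm (T f) <= M * sup_norm f.

Definition automorphism (R : realType) (X : topologicalType)
    (T : {linear cspace R X -> cspace R X}) :=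
  bounded_operator T /\
  exists S : cspace R X -> cspace R X,
    [/\ cancel T S, cancel S T & bounded_operator S].

Definition borel (X : ptopologicalType) : Type :=
  g_sigma_algebraType (@open X).

HB.instance Definition _ (X : ptopologicalType) := Measurable.on (borel X).

Section radon_measures.
Context {R : realType} {X : ptopologicalType}.
Implicit Types (mu : {charge set borel X -> \bar R}) (f : cspace R X).

Definition hahn_pos mu : set (borel X) := sval (cid (Hahn_decomposition mu)).

Definition hahn_neg mu : set (borel X) :=
  sval (cid (svalP (cid (Hahn_decomposition mu)))).

Lemma hahn_posneg mu : hahn_decomposition mu (hahn_pos mu) (hahn_neg mu).
Proof. exact: (svalP (cid (svalP (cid (Hahn_decomposition mu))))). Qed.

Definition variation mu := charge_variation (hahn_posneg mu).

(* signed finite Borel measures whose total variation is inner regular with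
   respect to compact sets *)
Definition radon mu :=
  forall B : set (borel X), measurable B ->
    variation mu B =
    ereal_sup [set variation mu K | K in [set K : set (borel X) |
      [/\ compact (K : set X), measurable K & K `<=` B]]].

Definition charge_integral mu f : R :=
  (\int[jordan_pos (hahn_posneg mu)]_x f x -
   \int[jordan_neg (hahn_posneg mu)]_x f x)%R.

(* the identification of bounded functionals with Radon measures *)
Definition represents mu (phi : cspace R X -> R) :=
  radon mu /\ forall f, phi f = charge_integral mu f.

(* G need not be Borel: the condition is that its complement is contained in
   a Borel set of variation 0. *)
Definition concentrated mu (G : set X) :=
  (variation mu).-negligible (~` G : set (borel X)).

End radon_measures.

Definition adjoint (R : realType) (X Y : topologicalType)
  (T : cspace R X -> cspace R Y) (phi : cspace R Y -> R) : cspace R X -> R :=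
  phi \o T.

(* the Dirac measure at y, as a functional *)
Definition dirac_functional (R : realType) (X : topologicalType) (y : X)
  (f : cspace R X) : R := f y.

(* By the Riesz representation theorem the Radon measure mu representing
   adjoint T (dirac_functional y) exists and is unique. *)
Definition funnelless (R : realType) (X : ptopologicalType)
    (T : cspace R X -> cspace R X) :=
  forall F : set X, nowhere_dense F ->
    exists2 G : set X, nowhere_dense G &
      forall y, F y -> exists2 mu : {charge set borel X -> \bar R},
        represents mu (adjoint T (dirac_functional y)) & concentrated mu G.

Section localization.
Context {R : realType}.

Lemma sigL_continuous (B : set nat) (f : cspace R Nstar) :
  continuous (sigL (star B) f).
Proof.
apply/subspace_sigL_continuousP; apply: continuous_subspaceT.
exact: cts_fun.
Qed.

(* P_B *)
Definition restriction (B : set nat) (f : cspace R Nstar) :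
    cspace R (star B) :=
  mkcts (@sigL_continuous B f).

Lemma valL_continuous (A : set nat) (f : cspace R (star A)) :
  continuous ('valL_ (0 : R) f : Nstar -> R).
Proof.
have [oA cA] := star_clopen A.
have : {within star A `|` ~` star A, continuous ('valL_ (0 : R) f)}.
  apply: withinU_continuous => //; first exact: open_closedC.
    by apply/subspace_valL_continuousP'; exact: cts_fun.
  apply: (@subspace_eq_continuous _ _ _ (cst (0 : R))).
    move=> x /set_mem nAx; rewrite /from_subspace /valL_ /= oinv_set_val insubN//.
    by apply/negP => /set_mem.
  by move=> x; exact: cvg_cst.
by rewrite setUv => h; apply/continuous_subspace_setT.
Qed.

(* I_A : extension by zero outside star A *)
Definition extension (A : set nat) (f : cspace R (star A)) :
    cspace R Nstar :=
  mkcts (@valL_continuous A f).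

(* T_{B,A} *)
Definition compression (T : cspace R Nstar -> cspace R Nstar)
    (B A : set nat) : cspace R (star A) -> cspace R (star B) :=
  @restriction B \o T \o @extension A.

End localization.

Arguments restriction {R} B f.
Arguments extension {R} A f.
Arguments compression {R} T B A f.

Definition canonizable_along (R : realType) (X Y : topologicalType)
    (S : cspace R X -> cspace R Y) (psi : Y -> X) :=
  [/\ continuous psi, range psi = setT &
      exists2 r : R, r != 0 & forall f y, S f y = r * f (psi y)].

(* Main.v *)
From HB Require Import structures.
From mathcomp Require Import all_boot all_order all_algebra.
From mathcomp Require Import all_classical all_reals all_analysis.
From mathcomp Require Import lra.
Require Import Defs.

(** Evaluating T on indicators turns it into a family of set functions: for y
    in N^*, m_y(C) = T(1_{C^*})(y) is a bounded finitely additive function of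
    C that vanishes on finite sets and depends continuously on y. Write
    v_y(A) for the variation of m_y on A; it is additive in A and lower
    semicontinuous in y. The proof is combinatorics of these set functions.
    It aims at a pair A1, B and a number r <> 0 such that m_y takes only the
    values 0 and r on subsets of A1, and m_y(A1) = r, for every y in B^*: then
    {C | m_y(C /\ A1) = r} is an ultrafilter psi(y), and T f = r f o psi holds
    for indicators, hence, as their span is uniformly dense, for all
    continuous f supported by A1^*.

    Since T is bounded below, sup_y v_y(A') stays away from 0. A diagonal
    (pseudo-intersection) argument shrinks A until this supremum is one number
    s > 0 for all infinite A' inside A (exists_variation_stable).

    The main step, full_variation_in_dense, chooses B inside any prescribed
    dense family D of infinite sets: there are A' inside A and B in D with
    sup_{y in B^*} v_y(A'') = s for every infinite A'' inside A'. Take a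
    maximal almost disjoint subfamily BB of D. The complement of the union of
    the B^*, B in BB, is nowhere dense, so T being funnelless lets one shrink
    A so that all m_y with y in that complement vanish on subsets of A. Then,
    for each C inside A, compactness makes m_y(C) small for y off finitely
    many of the B^*, and a gliding hump argument (small_off_finitely_many)
    upgrades this to v_y(A') <= s/2 off finitely many of them, for a smaller
    A'. Of finitely many B, one must carry the full variation s below some
    A'.

    It remains to choose D (dense_dichotomy). Below any set there is a B such
    that either all m_y, y in B^*, charge two complementary pieces of A by at
    least some d > 0, or m_y takes two values 0 and r as above and
    either psi maps B^* onto a set with empty interior, or it maps no smaller
    nonempty clopen set onto such a set. In the first case one of the two
    pieces meets A' in an infinite set, on which v_y <= s - d for y in B^*.
    That contradicts full variation, and so does an image with empty interior,
    since full variation makes psi hit every clopen subset of A'^*. The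
    remaining case is the conclusion (pure_pair). *)

Set Implicit Arguments.
Unset Strict Implicit.
Unset Printing Implicit Defensive.

Import Order.TTheory GRing.Theory Num.Theory.
Import numFieldNormedType.Exports.

Local Open Scope classical_set_scope.
Local Open Scope ring_scope.

(** * Infinite sets of naturals modulo finite sets *)

Lemma infinite_setS (A B : set nat) :
  A `<=` B -> infinite_set A -> infinite_set B.
Proof. by move=> AB iA fB; apply: iA; exact: sub_finite_set fB. Qed.

Lemma infinite_setD (A B : set nat) :
  finite_set B -> infinite_set A -> infinite_set (A `\` B).
Proof.
move=> fB iA fAB; apply: iA; apply: (@sub_finite_set _ _ ((A `\` B) `|` B)).
  by move=> n An; have [Bn|nBn] := pselect (B n); [right|left].
by rewrite finite_setU.
Qed.

Lemma finite_initial_segment (n : nat) : finite_set [set k | (k <= n)%O].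
Proof.
apply: (@sub_finite_set _ _ `I_n.+1); last exact: finite_II.
by move=> k /=; rewrite ltnS.
Qed.

Lemma infinite_set_gt (A : set nat) (N : nat) :
  infinite_set A -> exists2 k, A k & (N < k)%N.
Proof.
move=> iA.
have [f [_ Nf Af]] := infinite_increasing_seq_wf finite_initial_segment iA N.
by exists (f 0%N); [exact: Af|exact: Nf].
Qed.

Lemma unbounded_infinite_set (A : set nat) :
  (forall N, exists2 k, A k & (N <= k)%N) -> infinite_set A.
Proof.
move=> uA /finite_fsetP[X AX].
have [k] := uA (\max_(i <- finmap.enum_fset X) i).+1.
rewrite AX /= => kX; rewrite ltnNge => /negP; apply.
exact: (@leq_bigmax_seq _ _ xpredT id).
Qed.

(** The set C picks one element from each B n, in increasing order. *)
Lemma pseudo_intersection (B : nat -> set nat) :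
  (forall n, infinite_set (B n)) -> (forall n, B n.+1 `<=` B n) ->
  exists C, [/\ infinite_set C, C `<=` B 0%N &
    forall n, finite_set (C `\` B n)].
Proof.
move=> iB dB.
have mB m n : (m <= n)%N -> B n `<=` B m.
  elim: n => [|n IH]; first by rewrite leqn0 => /eqP ->.
  by rewrite leq_eqVlt => /predU1P[->//|/IH mn x /dB /mn].
have pick (p : nat * nat) : {q : nat * nat |
    [/\ q.1 = p.1.+1, B q.1 q.2 & (p.2 < q.2)%N]}.
  by apply: cid; have [k Bk pk] := infinite_set_gt p.2 (iB p.1.+1); exists (p.1.+1, k).
have [k0 Bk0 _] := infinite_set_gt 0%N (iB 0%N).
have [f [f0 fS]] := dependent_choice pick (0%N, k0).
have f1 n : (f n).1 = n by elim: n => [|n IH]; [rewrite f0|have [-> _ _] := fS n; rewrite IH].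
have Bf n : B n (f n).2.
  by case: n => [|n]; [rewrite f0|have [_ + _] := fS n; rewrite f1].
have f2 n : (n <= (f n).2)%N.
  by elim: n => // n IH; have [_ _] := fS n; exact: leq_ltn_trans.
exists (range (fun n => (f n).2)); split.
- by apply: unbounded_infinite_set => N; exists (f N).2 => //; exists N.
- by move=> _ [n _ <-]; exact: mB (Bf n).
- move=> n; apply: (@sub_finite_set _ _ [set (f m).2 | m in `I_n]).
    move=> _ [[m _ <-] nB]; exists m => //=; rewrite ltnNge; apply/negP => nm.
    by apply: nB; exact: mB (Bf m).
  exact/finite_image/finite_II.
Qed.

Lemma split_infinite (A : set nat) : infinite_set A ->
  exists B, [/\ B `<=` A, infinite_set B & infinite_set (A `\` B)].
Proof.
move=> iA.
have [f [fi _ Af]] := infinite_increasing_seq_wf finite_initial_segment iA 0%N.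
have finj : injective f by apply: inc_inj => a b; exact: fi.
have fge n : (n <= f n)%N.
  elim: n => // n IH; apply: leq_ltn_trans IH _.
  have e : (f n.+1 <= f n)%N = (n.+1 <= n)%N := fi n.+1 n.
  by rewrite ltnNge e ltnn.
exists (range (fun n => f n.*2)); split.
- by move=> _ [n _ <-]; exact: Af.
- apply: unbounded_infinite_set => N; exists (f N.*2); first by exists N.
  by rewrite (leq_trans _ (fge _))// -addnn leq_addr.
- apply: unbounded_infinite_set => N; exists (f N.*2.+1).
    split; first exact: Af.
    by move=> [n _ /finj/(congr1 odd)]; rewrite /= !odd_double.
  by rewrite (leq_trans _ (fge _))// -addnn -addnS leq_addr.
Qed.

(** Choose a decreasing sequence of sets along which s approaches, within
    1/(n+1), its infimum over the infinite subsets of the previous one; a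
    pseudo-intersection of the sequence cannot be improved any further. *)
Lemma constant_below (R : realType) (s : set nat -> R) :
  (forall A B, infinite_set A -> finite_set (A `\` B) -> s A <= s B) ->
  (exists K, forall A, infinite_set A -> K <= s A) ->
  forall A, infinite_set A ->
  exists A0, [/\ infinite_set A0, A0 `<=` A &
    forall A', infinite_set A' -> A' `<=` A0 -> s A' = s A0].
Proof.
move=> s_mono [K sK] A iA.
have sS A' B : infinite_set A' -> A' `<=` B -> s A' <= s B.
  by move=> iA' A'B; apply: s_mono => //; have -> : A' `\` B = set0 by rewrite setD_eq0.
pose good (n : nat) (A1 A2 : set nat) := A2 `<=` A1 /\
  forall A', infinite_set A' -> A' `<=` A1 -> s A2 <= s A' + n.+1%:R^-1.
have shrink (p : nat * {A1 : set nat | infinite_set A1}) :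
    {q : nat * {A1 : set nat | infinite_set A1} |
     q.1 = p.1.+1 /\ good p.1 (sval p.2) (sval q.2)}.
  apply: cid; case: p => n [A1 iA1] /=.
  pose E := [set s A' | A' in [set A' | infinite_set A' /\ A' `<=` A1]].
  have hE : has_inf E.
    split; first by exists (s A1); exists A1 => //; split=> //; exact: subset_refl.
    by exists K => _ [A' [iA' _] <-]; exact: sK.
  have n0 : 0 < n.+1%:R^-1 :> R by rewrite invr_gt0.
  have [_ [A2 [iA2 A21] <-] A2E] := inf_adherent n0 hE.
  exists (n.+1, exist _ A2 iA2); split=> //=; split=> // A' iA' A'1.
  apply: ltW; apply: lt_le_trans A2E _; rewrite lerD2r.
  by apply: ge_inf; [exact: hE.2|exists A'].
have [f [f0 fS]] := dependent_choice shrink (0%N, exist _ A iA).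
have f1 n : (f n).1 = n.
  by elim: n => [|n IH]; [rewrite f0|have [-> _] := fS n; rewrite IH].
pose B n := sval (f n).2.
have Bg n : good n (B n) (B n.+1) by have [_] := fS n; rewrite f1.
have iB n : infinite_set (B n) by exact: (svalP (f n).2).
have [C [iC C0 CB]] := pseudo_intersection iB (fun n => (Bg n).1).
exists C; split=> //; first by move: C0; rewrite /B f0.
move=> A' iA' A'C; apply/eqP; rewrite eq_le sS//=.
apply/ler_addgt0Pl => e e0.
have [N _ /(_ N (leqnn N)) /= Ne] := near_infty_natSinv_lt (PosNum e0).
apply: le_trans (s_mono _ (B N.+1) iC (CB N.+1)) _.
have fA' : finite_set (A' `\` B N).
  by apply: sub_finite_set (CB N) => n [/A'C].
have iA'B : infinite_set (A' `&` B N).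
  by rewrite -setDD; exact: infinite_setD.
apply: le_trans ((Bg N).2 _ iA'B (@subIsetr _ _ _)) _.
rewrite addrC; apply: lerD; first exact: ltW.
by apply: sS => //; exact: subIsetl.
Qed.

(** * Clopen sets and points of the remainder *)

Lemma starS (A B : set nat) : A `<=` B -> star A `<=` star B.
Proof. by move=> AB y /starP yA; apply/starP; exact: (@filterS _ (betaN_sets (set_val y))) yA. Qed.

Lemma starI (A B : set nat) (y : Nstar) : star A y -> star B y -> star (A `&` B) y.
Proof. by move=> /starP yA /starP yB; apply/starP; exact: (@filterI _ (betaN_sets (set_val y))). Qed.

Lemma starC (A : set nat) (y : Nstar) : star (~` A) y <-> ~ star A y.
Proof.
split=> [/starP ynA /starP yA|nA]; first by have [n []] := betaN_meet ynA yA.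
apply/starP; have [/starP//|//] := in_ultra_setVsetC A (betaN_ultra (set_val y)).
Qed.

Lemma starU (A B : set nat) (y : Nstar) :
  star (A `|` B) y <-> star A y \/ star B y.
Proof.
split=> [yAB|[]]; last 2 first.
- exact: starS.
- exact: starS.
have [|/starC nA] := pselect (star A y); first by left.
right; apply: (starS _ (starI yAB nA)) => n [[]//].
Qed.

Lemma starT (y : Nstar) : star setT y.
Proof. by apply/starP; exact: (@filterT _ (betaN_sets (set_val y))). Qed.

(** An ultrafilter containing an initial segment of the naturals is principal. *)
Lemma star_infinite (A : set nat) (y : Nstar) : star A y -> infinite_set A.
Proof.
move=> yA fA.
have [N AN] : exists N, A `<=` `I_N.
  apply: contrapT => nN; move: fA; apply: unbounded_infinite_set => N.
  apply: contrapT => nk; apply: nN; exists N => k Ak /=.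
  by rewrite ltnNge; apply/negP => Nk; apply: nk; exists k.
have {yA AN} := starS AN yA; elim: N => [|N IH] yN.
  have /starP := yN; rewrite II0 => y0.
  by have [n []] := betaN_meet y0 y0.
apply: IH; apply: contrapT => /starC nN.
have /starP y1 : star [set N] y.
  apply: starS (starI yN nN) => k /= [kN] /negP; rewrite -leqNgt => Nk.
  by apply/eqP; rewrite eqn_leq Nk -ltnS kN.
have /set_mem := valP y; apply; exists N => //.
have e : principal_filter N = betaN_sets (set_val y).
  apply/seteqP; split=> B; rewrite principal_filterP.
    by move=> BN; apply: (@filterS _ (betaN_sets (set_val y))) y1 => k ->.
  by move=> yB; have [k [/= -> ]] := betaN_meet y1 yB.
have peq (p q : betaN) : betaN_sets p = betaN_sets q -> p = q.
  by case: p q => p Up [q Uq] /= pq; subst q; congr BetaN; exact: Prop_irrelevance.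
exact: peq.
Qed.

Lemma star_almostS (A B : set nat) :
  finite_set (A `\` B) -> star A `<=` star B.
Proof.
move=> fAB y yA; apply: contrapT => /starC nB.
exact: (star_infinite (starI yA nB)).
Qed.

Lemma star_cofinite (E : set nat) (y : Nstar) : finite_set (~` E) -> star E y.
Proof.
by move=> fE; apply: (star_almostS (A := setT)); [rewrite setTD|exact: starT].
Qed.

(** Compactness of the remainder as a covering induction: if no member of the
    ideal P were cofinite, the complements of the members of P would generate,
    together with the cofinite sets, a filter, and a point extending it could
    not be in C^* for any C in P. Working with sets of naturals instead of
    open covers keeps the clopen sets explicit. *)
Lemma Nstar_exhaust (P : set nat -> Prop) :
  P set0 -> (forall C D, P C -> P D -> P (C `|` D)) ->
  (forall y : Nstar, exists2 C, star C y & P C) ->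
  exists2 C, P C & finite_set (~` C).
Proof.
move=> P0 PU Py; apply: contrapT => nP.
pose F : set_system nat := [set A | exists2 C, P C & finite_set (~` (A `|` C))].
have FF : ProperFilter F.
  split=> [[C PC]|]; first by rewrite set0U => fC; apply: nP; exists C.
  split=> [|A B [C PC fA] [D PD fB]|A B AB [C PC fA]].
  - by exists set0 => //; rewrite setU0 setCT; exact: finite_set0.
  - exists (C `|` D); first exact: PU.
    apply: (@sub_finite_set _ _ (~` (A `|` C) `|` ~` (B `|` D))); last first.
      by rewrite finite_setU.
    by move=> n /= nAB; apply: contrapT; tauto.
  - by exists C => //; apply: sub_finite_set fA => n /= + h; apply; case: h; [left; exact: AB|right].
have [p [Up Fp]] := ultraFilterLemma FF.
have rp : remainder (BetaN Up).
  move=> [n _ En].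
  have : p (~` [set n]).
    apply: Fp; exists set0 => //; rewrite setU0 setCK; exact: finite_set1.
  by rewrite -[p]/(betaN_sets (BetaN Up)) -En => /principal_filterP; apply.
pose y : Nstar := exist _ (BetaN Up) (mem_set rp).
have [C /starP yC PC] := Py y.
have pC : betaN_sets (set_val y) (~` C).
  by apply: Fp; exists C => //; rewrite setUCl setCT; exact: finite_set0.
by have [n []] := betaN_meet yC pC.
Qed.

(** Otherwise the sets almost disjoint from A would exhaust the remainder. *)
Lemma star_nonempty (A : set nat) : infinite_set A -> star A !=set0.
Proof.
move=> iA; apply: contrapT => nA.
have [||y|C fCA fC] := @Nstar_exhaust (fun C => finite_set (C `&` A)).
- by rewrite set0I; exact: finite_set0.
- by move=> C D; rewrite setIUl finite_setU.
- exists (~` A); last by rewrite setICl; exact: finite_set0.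
  by apply/starC => yA; apply: nA; exists y.
- apply: iA; apply: (@sub_finite_set _ _ (C `&` A `|` ~` C)); last by rewrite finite_setU.
  by move=> n An; have [Cn|nC] := pselect (C n); [left|right].
Qed.

Lemma star_open (A : set nat) : open (star A).
Proof. by have [] := star_clopen A. Qed.

Lemma nbhs_star (y : Nstar) (U : set Nstar) :
  nbhs y U <-> exists2 C, star C y & star C `<=` U.
Proof.
split=> [|[C yC CU]]; last first.
  by apply: filterS CU _; apply: open_nbhs_nbhs; split=> //; exact: star_open.
rewrite nbhsE => -[V [[W oW <-] Wy] VU].
have : nbhs (set_val y) W by apply: open_nbhs_nbhs.
rewrite nbhsE => -[W' [[D _ <-] [C DC yC]] W'W].
exists C; first exact/starP.
by move=> z /starP zC; apply: VU; apply: W'W; exists C.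
Qed.

Lemma locally_decided_star (U : set Nstar) :
  (forall y, exists2 E, star E y & star E `<=` U \/ star E `<=` ~` U) ->
  exists D, U = star D.
Proof.
move=> UE.
have [||y|E [D DP] fE] := @Nstar_exhaust (fun E => exists D,
    forall y, star D y <-> star E y /\ U y).
- by exists set0 => y; split=> [/star_infinite/(_ (finite_set0 _))|[/star_infinite/(_ (finite_set0 _))]].
- move=> E E' [D DP] [D' DP']; exists (D `|` D') => y.
  have := DP y; have := DP' y; have := starU E E' y; have := starU D D' y; tauto.
- have [E yE [EU|EU]] := UE y; exists E => //.
    by exists E => z; split=> [zE|[]//]; split=> //; exact: EU.
  exists set0 => z; split=> [/star_infinite/(_ (finite_set0 _))//|[/EU]//].
- exists D; apply/seteqP; split=> y; last by move=> /DP[].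
  move=> Uy; apply/DP; split=> //.
  exact: star_cofinite.
Qed.

Lemma Nstar_eq (x y : Nstar) : (forall C, star C x -> star C y) -> x = y.
Proof.
move=> xy; apply: val_inj.
have e : betaN_sets (val y) = betaN_sets (val x).
  apply: (max_filter (UltraFilter := betaN_ultra (val x))) => C.
  by move=> /starP/xy/starP.
move: e; case: (val x) (val y) => [p Up] [q Uq] /= qp; subst q.
by congr BetaN; exact: Prop_irrelevance.
Qed.

Lemma nbhs_star_sub (A : set nat) (y : star A) (U : set (star A)) :
  nbhs y U <-> exists2 C, star C (val y) & [set z | star C (val z)] `<=` U.
Proof.
split=> [|[C yC CU]].
  rewrite nbhsE => -[V [[W oW <-] Wy] VU].
  have /nbhs_star[C yC CW] : nbhs (val y) W by apply: open_nbhs_nbhs.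
  by exists C => // z zC; apply: VU; apply: CW.
apply: filterS CU _; apply: open_nbhs_nbhs; split=> //.
by exists (star C) => //; exact: star_open.
Qed.

Lemma Nstar_of_family (U : set (set nat)) :
  U setT -> (forall C D, U C -> U D -> U (C `&` D)) ->
  (forall C D, C `<=` D -> U C -> U D) -> (forall C, U C \/ U (~` C)) ->
  (forall C, finite_set C -> ~ U C) ->
  exists x : Nstar, forall C, star C x <-> U C.
Proof.
move=> UT UI US UC Uf.
have PU : ProperFilter U.
  split; first exact: (Uf _ (finite_set0 _)).
  by split; [exact: UT|exact: UI|exact: US].
have UU : UltraFilter U.
  split=> // G PG UG; apply/seteqP; split=> // C GC.
  have [//|/UG GnC] := UC C.
  have G0 : G (C `&` ~` C) by exact: filterI.
  by exfalso; apply: (@filter_not_empty _ G PG); rewrite -(setICr C).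
have rU : remainder (BetaN UU).
  move=> [n _ nU]; apply: (Uf [set n]) => //.
  by rewrite -[U]/(betaN_sets (BetaN UU)) -nU; apply/principal_filterP.
by exists (exist _ (BetaN UU) (mem_set rU)) => C; split=> [/starP|UC'] //; apply/starP.
Qed.

(** * Continuous families of finitely additive set functions *)

(** The family y |-> m_y; boundedness is uniform in y. In the application these
    are the measures representing f |-> T f y, restricted to clopen sets. *)
Record fa_kernel (R : realType) := FaKernel {
  fa_fun :> Nstar -> set nat -> R;
  faU : forall y A B, A `&` B = set0 -> fa_fun y (A `|` B) = fa_fun y A + fa_fun y B;
  fa_finite : forall y A, finite_set A -> fa_fun y A = 0;
  fa_bounded : exists M, forall y A, `|fa_fun y A| <= M;
  fa_continuous : forall A, continuous (fa_fun^~ A) }.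

Section variation.
Context {R : realType} (m : fa_kernel R).
Implicit Types (y : Nstar) (A B C : set nat).

(** The variation of m_y on A: grouping the pieces of a partition by the sign of
    their mass shows that splittings into two parts suffice. In this form it
    is visibly a supremum of continuous functions of y. *)
Definition fa_var y A : R := sup [set m y C - m y (A `\` C) | C in [set C | C `<=` A]].

Lemma faD y A B : B `<=` A -> m y A = m y B + m y (A `\` B).
Proof.
by move=> BA; rewrite -faU ?setDIK// setDUK.
Qed.

Lemma fa0 y : m y set0 = 0. Proof. exact/fa_finite/finite_set0. Qed.

Let fa_var_has_sup y A :
  has_sup [set m y C - m y (A `\` C) | C in [set C | C `<=` A]].
Proof.
split; first by exists (m y A - m y (A `\` A)), A.
have [M mM] := fa_bounded m; exists (M + M) => _ [C _ <-].
by rewrite (le_trans (ler_norm _))// (le_trans (ler_normB _ _))// lerD.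
Qed.

Lemma fa_var_ub y A C : C `<=` A -> m y C - m y (A `\` C) <= fa_var y A.
Proof.
by move=> CA; apply: ub_le_sup; [case: (fa_var_has_sup y A)|exists C].
Qed.

Lemma fa_var_lub y A t :
  (forall C, C `<=` A -> m y C - m y (A `\` C) <= t) -> fa_var y A <= t.
Proof.
move=> At; apply: ge_sup; first by case: (fa_var_has_sup y A).
by move=> _ [C CA <-]; exact: At.
Qed.

Lemma fa_var_gt y A t :
  t < fa_var y A -> exists2 C, C `<=` A & t < m y C - m y (A `\` C).
Proof.
by case/sup_gt => [|_ [C CA <-] tC]; [case: (fa_var_has_sup y A)|exists C].
Qed.

Lemma fa_varU y A B : A `&` B = set0 ->
  fa_var y (A `|` B) = fa_var y A + fa_var y B.
Proof.
move=> AB; have dAB n : A n -> B n -> False.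
  by move=> An Bn; have : set0 n by rewrite -AB.
apply/eqP; rewrite eq_le; apply/andP; split.
  apply: fa_var_lub => C CAB.
  have -> : m y C = m y (C `&` A) + m y (C `&` B).
    rewrite -faU; last by apply/seteqP; split=> // n [[_ /dAB] + [_ Bn]]; exact.
    by congr (m y _); apply/seteqP; split=> n; [move=> Cn; have [] := CAB _ Cn; [left|right]|case; case].
  have -> : m y ((A `|` B) `\` C) = m y (A `\` (C `&` A)) + m y (B `\` (C `&` B)).
    rewrite -faU; last by apply/seteqP; split=> // n [[/dAB + _] [Bn _]]; exact.
    by congr (m y _); apply/seteqP; split=> n /=; tauto.
  have := fa_var_ub y (@subIsetr _ C A); have := fa_var_ub y (@subIsetr _ C B); lra.
rewrite -lerBrDr; apply: fa_var_lub => C CA.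
rewrite lerBrDr addrC -lerBrDr; apply: fa_var_lub => D DB; rewrite lerBrDr.
have CD : C `|` D `<=` A `|` B by move=> n [/CA|/DB]; [left|right].
apply: le_trans (fa_var_ub y CD).
have -> : (A `|` B) `\` (C `|` D) = (A `\` C) `|` (B `\` D).
  apply/seteqP; split=> n /=; first by tauto.
  move=> [[An nC]|[Bn nD]]; split; [by left| |by right|].
    by move=> [//|/DB]; exact: dAB.
  by move=> [/CA An|//]; exact: dAB An Bn.
rewrite !faU; first lra.
- by apply/seteqP; split=> // n [[/dAB + _] [Bn _]]; exact.
- by apply/seteqP; split=> // n [/CA/dAB + /DB]; exact.
Qed.

Lemma fa_norm_le y C : `|m y C| <= fa_var y C.
Proof.
have := fa_var_ub y (@subset_refl _ C); have := fa_var_ub y (@sub0set _ C).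
by rewrite setDv setD0 fa0 subr0 sub0r ler_norml => *; lra.
Qed.

Lemma fa_var_ge0 y A : 0 <= fa_var y A.
Proof. exact: le_trans (fa_norm_le y A). Qed.

Lemma fa_varD y A B : B `<=` A -> fa_var y A = fa_var y B + fa_var y (A `\` B).
Proof. by move=> BA; rewrite -fa_varU ?setDIK// setDUK. Qed.

Lemma fa_varS y A B : A `<=` B -> fa_var y A <= fa_var y B.
Proof. by move=> AB; rewrite (fa_varD y AB) lerDl fa_var_ge0. Qed.

Lemma fa_var_finite y A : finite_set A -> fa_var y A = 0.
Proof.
move=> fA; apply/eqP; rewrite eq_le fa_var_ge0 andbT; apply: fa_var_lub => C CA.
by rewrite !fa_finite ?subr0//; apply: sub_finite_set fA => // n [].
Qed.

Lemma fa_var_almostS y A B : finite_set (A `\` B) -> fa_var y A <= fa_var y B.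
Proof.
move=> fAB; rewrite (fa_varD y (@subIsetl _ A B)) setDIr setDv set0U.
by rewrite (fa_var_finite y fAB) addr0; apply: fa_varS; exact: subIsetr.
Qed.

Lemma fa_var_eq0 y A : (forall C, C `<=` A -> m y C = 0) -> fa_var y A = 0.
Proof.
move=> m0; apply/eqP; rewrite eq_le fa_var_ge0 andbT; apply: fa_var_lub => C CA.
by rewrite !m0 ?subr0//; exact: subIset (or_introl _).
Qed.

Lemma fa_eq0 y A C : C `<=` A -> fa_var y A = 0 -> m y C = 0.
Proof.
move=> CA vA; apply/eqP; rewrite -normr_le0 -vA.
exact: le_trans (fa_norm_le y C) (fa_varS y CA).
Qed.

Lemma fa_var_bounded : exists M, forall y A, fa_var y A <= M.
Proof.
have [M mM] := fa_bounded m; exists (M + M) => y A; apply: fa_var_lub => C _.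
by rewrite (le_trans (ler_norm _))// (le_trans (ler_normB _ _))// lerD.
Qed.

Lemma fa_var_lsc y A t : t < fa_var y A ->
  exists2 C, star C y & forall z, star C z -> t < fa_var z A.
Proof.
move=> /fa_var_gt[D DA tD].
have h : ((m^~ D \- m^~ (A `\` D)) : Nstar -> R) z @[z --> y] -->
    m y D - m y (A `\` D).
  exact: (cvgB (@fa_continuous _ m D y) (@fa_continuous _ m (A `\` D) y)).
have /nbhs_star[C yC Ct] : nbhs y [set z | t < m z D - m z (A `\` D)].
  exact: (cvgr_gt _ h _ tD).
by exists C => // z /Ct /= tz; exact: lt_le_trans tz (fa_var_ub z DA).
Qed.

(** On a set below which the variation is constant, it equals twice itself:
    split the set into two infinite parts. *)
Lemma fa_var_vanish y A : infinite_set A ->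
  exists A', [/\ A' `<=` A, infinite_set A' & fa_var y A' = 0].
Proof.
move=> iA; have [||A0 [iA0 A0A vA0]] := @constant_below _ (fa_var y) _ _ A iA.
- by move=> B C _; exact: fa_var_almostS.
- by exists 0 => B _; exact: fa_var_ge0.
have [B [BA0 iB iA0B]] := split_infinite iA0.
exists B; split=> //; first exact: subset_trans A0A.
have := fa_varD y BA0; rewrite (vA0 _ iB)// (vA0 _ iA0B); last exact: subDsetl.
by move=> *; lra.
Qed.

End variation.

(** * Full variation on a member of a dense family *)

Definition dense_family (D : set (set nat)) :=
  forall B, infinite_set B -> exists B', [/\ B' `<=` B, infinite_set B' & D B'].

Definition almost_disjoint (BB : set (set nat)) :=
  forall B B', BB B -> BB B' -> B <> B' -> finite_set (B `&` B').

Lemma maximal_almost_disjoint (D : set (set nat)) : dense_family D ->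
  exists BB, [/\ BB `<=` D, almost_disjoint BB &
    forall C, infinite_set C -> exists2 B, BB B & infinite_set (C `&` B)].
Proof.
move=> dD.
have [|BB [[BD aBB] BBmax]] :=
    @Zorn_bigcup _ (fun BB => BB `<=` D /\ almost_disjoint BB).
  move=> /= FF FP tF; split=> [B [BB /FP[+ _]]|B B' [BB FBB BBB] [BB' FBB' BB'B]].
    by apply.
  have [BB1|BB1] := tF _ _ FBB FBB'.
    by have [_] := FP _ FBB'; apply => //; exact: BB1.
  by have [_] := FP _ FBB; apply => //; exact: BB1.
exists BB; split=> // C iC; apply: contrapT => nC.
have [C' [C'C iC' DC']] := dD C iC.
have finC B : BB B -> finite_set (C' `&` B).
  move=> BBB; apply: contrapT => iCB; apply: nC; exists B => //.
  by apply: infinite_setS iCB; exact: setSI.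
have nC' : ~ BB C' by move=> /finC; rewrite setIid.
apply: (BBmax (BB `|` [set C'])).
  rewrite properEneq; split; last exact: subsetUl.
  by apply/eqP => e; apply: nC'; rewrite e; right.
split=> [B [/BD//|->//]|B B' [BBB|->] [BBB'|->]].
- exact: aBB.
- by move=> _; rewrite setIC; exact: finC.
- by move=> _; exact: finC.
- by [].
Qed.

(** By maximality every C^* meets some B^* in a nonempty clopen set. *)
Lemma nowhere_dense_remainder (BB : set (set nat)) :
  (forall C, infinite_set C -> exists2 B, BB B & infinite_set (C `&` B)) ->
  nowhere_dense (~` \bigcup_(B in BB) star B).
Proof.
move=> BBd; rewrite /nowhere_dense -(closure_id _).1; last first.
  by rewrite closedC; apply: bigcup_open => B _; exact: star_open.
rewrite -subset0 => y /nbhs_star[C /star_infinite/BBd[B BBB iCB] CF].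
have [z zCB] := star_nonempty iCB.
apply: (CF z); first exact: starS zCB.
by exists B => //; exact: starS zCB.
Qed.

Section full_variation.
Context {R : realType} (m : fa_kernel R).

(** Outside the union of the B^* the continuous function |m_y(C)| vanishes, so
    the compact set where it is at least e is covered by finitely many B^*. *)
Lemma fa_cover (BB : set (set nat)) (C : set nat) (e : R) : 0 < e ->
  (forall y, (forall B, BB B -> ~ star B y) -> m y C = 0) ->
  exists J, [/\ finite_set J, J `<=` BB &
    forall y, e <= `|m y C| -> exists2 B, J B & star B y].
Proof.
move=> e0 mC.
have [||y|E [J [fJ JBB JP]] fE] := @Nstar_exhaust (fun E => exists J,
    [/\ finite_set J, J `<=` BB & forall y, star E y -> e <= `|m y C| ->
      exists2 B, J B & star B y]).
- exists set0; split=> //.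
  by move=> y /star_infinite/(_ (finite_set0 _)).
- move=> E E' [J [fJ JBB JP]] [J' [fJ' J'BB J'P]]; exists (J `|` J'); split.
  + by rewrite finite_setU.
  + by rewrite subUset.
  + move=> y /starU[/JP|/J'P] + ey => /(_ ey)[B BJ yB]; exists B => //.
      by left.
    by right.
- have [[B BBB yB]|nB] := pselect (exists2 B, BB B & star B y).
    exists B => //; exists [set B]; split=> //; first by move=> _ ->.
    by move=> z zB _; exists B.
  have my0 : m y C = 0 by apply: mC => B BBB yB; apply: nB; exists B.
  have /nbhs_star[E yE EC] : nbhs y [set z | `|m z C| < e].
    have h : (fun z => `|m z C|) z @[z --> y] --> `|m y C|.
      exact: (cvg_norm (@fa_continuous _ m C y)).
    by apply: (cvgr_lt _ h); rewrite my0 normr0.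
  exists E => //; exists set0; split=> //.
  by move=> z /EC/= + ez; rewrite ltNge ez.
- exists J; split=> // y; apply: JP.
  exact: star_cofinite.
Qed.

(** Gliding hump. If the conclusion fails, choose successively a point y_n in
    a new B_n^*, a hump C_n inside A_n with |m_{y_n}(C_n)| > e/2, and A_{n+1}
    inside A_n, disjoint from C_n, with v_{y_n}(A_{n+1}) = 0. As y_n is
    outside the finitely many members covering the points where the union S_n
    of the earlier humps is charged by e/4 or more, and the later humps lie
    in A_{n+1}, the union E of all humps has |m_{y_n}(E)| >= e/4 for all n.
    By [fa_cover] for E, only finitely many B_n can occur. *)
Lemma small_off_finitely_many (BB : set (set nat)) (A : set nat) (e : R) :
  almost_disjoint BB -> infinite_set A -> 0 < e ->
  (forall y, (forall B, BB B -> ~ star B y) -> fa_var m y A = 0) ->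
  exists A' J, [/\ A' `<=` A, infinite_set A', finite_set J, J `<=` BB &
    forall y, (forall B, J B -> ~ star B y) -> fa_var m y A' <= e].
Proof.
move=> aBB iA e0 m0; apply: contrapT => nAJ.
have cover C d : C `<=` A -> 0 < d -> exists J, [/\ finite_set J, J `<=` BB &
    forall y, d <= `|m y C| -> exists2 B, J B & star B y].
  move=> CA d0; apply: fa_cover => // y /m0 vA.
  exact: fa_eq0 CA vA.
(* A state is (A_n, the members of BB excluded so far, S_n). *)
pose inv (x : set nat * set (set nat) * set nat) :=
  [/\ infinite_set x.1.1, x.1.1 `<=` A, finite_set x.1.2, x.1.2 `<=` BB &
      x.2 `<=` A /\ x.2 `&` x.1.1 = set0].
pose step (x x' : set nat * set (set nat) * set nat) := inv x ->
  inv x' /\ exists y B, [/\ BB B, ~ x.1.2 B, x'.1.2 B & star B y] /\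
    [/\ x'.1.1 `<=` x.1.1, x.1.2 `<=` x'.1.2, x.2 `<=` x'.2 &
        x'.2 `<=` x.2 `|` x.1.1] /\
    fa_var m y x'.1.1 = 0 /\ e / 4 <= `|m y x'.2|.
have next x : {x' | step x x'}.
  apply: cid; have [|ninv] := pselect (inv x); last by exists x.
  case: x => [[A1 J] S] [/= iA1 A1A fJ JBB [SA SA1]].
  have [|J1 [fJ1 J1BB J1P]] := @cover S (e / 4) SA; first by lra.
  have [y [yJ ey]] : exists y, (forall B, (J `|` J1) B -> ~ star B y) /\
      e < fa_var m y A1.
    apply: contrapT => ny; apply: nAJ; exists A1, (J `|` J1); split=> //.
    - by rewrite finite_setU.
    - by rewrite subUset.
    - move=> y yJ; rewrite leNgt; apply/negP => ey; apply: ny; exists y.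
      by split.
  have [B BBB yB] : exists2 B, BB B & star B y.
    apply: contrapT => nB; move: ey; rewrite ltNge => /negP; apply.
    have vA : fa_var m y A = 0 by apply: m0 => B BBB yB; apply: nB; exists B.
    by rewrite (le_trans (fa_varS _ _ A1A))// vA ltW.
  (* One of the two halves witnessing v_y(A1) > e has mass above e/2. *)
  have [C CA1 eC] : exists2 C, C `<=` A1 & e / 2 < `|m y C|.
    have [D DA1] := fa_var_gt ey => eD.
    have [eD1|eD1] := ltP (e / 2) `|m y D|; first by exists D.
    exists (A1 `\` D); first exact: subDsetl.
    move: eD1 (ler_norm (m y D)) (ler_norm (- m y (A1 `\` D))).
    by rewrite normrN => *; lra.
  have [A2 [A2A1 iA2 vA2]] := fa_var_vanish m y iA1.
  have mC : m y C = m y (C `\` A2).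
    rewrite (@faD _ _ y C (C `&` A2)) ?setDIr ?setDv ?set0U//.
    suff -> : m y (C `&` A2) = 0 by rewrite add0r.
    by apply: fa_eq0 vA2; exact: subIsetr.
  have mS : `|m y S| < e / 4.
    rewrite ltNge; apply/negP => /J1P[B1 J1B1]; apply: yJ; by right.
  have CS : S `&` (C `\` A2) = set0.
    apply/seteqP; split=> // n [Sn [/CA1 A1n _]].
    by rewrite -SA1.
  exists (A2, J `|` J1 `|` [set B], S `|` (C `\` A2)) => _; split.
    split=> //=.
    - exact: subset_trans A1A.
    - by rewrite !finite_setU; split=> //; exact: finite_set1.
    - by rewrite !subUset; split=> // _ ->.
    - split; first by rewrite subUset; split=> // n [/CA1/A1A].
      apply/seteqP; split=> // n [[Sn /A2A1 A1n|[_ //]]].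
      by rewrite -SA1.
  exists y, B; split=> /=; first split=> //.
  - by move=> JB; apply: (yJ B) => //; left.
  - by right.
  split; last first.
    split=> //; rewrite faU// -mC.
    have := lerB_normD (m y C) (m y S); rewrite (addrC (m y S)); lra.
  split=> //.
  - by move=> B' JB'; left; left.
  - by apply: setUS => n [/CA1].
have [f [f0 fS]] := dependent_choice next (A, set0, set0).
have finv n : inv (f n).
  elim: n => [|n /fS[//]]; rewrite f0; split=> //=.
  by split=> //; rewrite set0I.
have fstep n := (fS n (finv n)).2.
pose E := \bigcup_n (f n).2.
have EA : E `<=` A by move=> k [n _]; have [_ _ _ _ []] := finv n => + _; apply.
have fA n k : (f (n + k)%N).1.1 `<=` (f n).1.1.
  elim: k => [|k IH]; rewrite ?addn0// addnS.
  by have [y [B [_ [[+ _ _ _] _]]]] := fstep (n + k)%N; move=> /subset_trans; apply.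
have fJ n k : (f n).1.2 `<=` (f (n + k)%N).1.2.
  elim: k => [|k IH]; rewrite ?addn0// addnS.
  by have [y [B [_ [[_ + _ _] _]]]] := fstep (n + k)%N; apply: subset_trans.
have fE n k : (f (n + k)%N).2 `<=` (f n).2 `|` (f n).1.1.
  elim: k => [|k IH]; rewrite ?addn0//.
  rewrite addnS; have [y [B [_ [[_ _ _ S1] _]]]] := fstep (n + k)%N.
  by move=> j /S1[/IH//|/fA]; right.
have fEmono n k : (f n).2 `<=` (f (n + k)%N).2.
  elim: k => [|k IH]; rewrite ?addn0// addnS.
  by have [y [B [_ [[_ _ + _] _]]]] := fstep (n + k)%N; apply: subset_trans.
have Ediff n : E `\` (f n).2 `<=` (f n).1.1.
  move=> j [[k _ fkj] nfj]; have [nk|kn] := leqP n k.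
    by have := fE n (k - n)%N; rewrite subnKC// => /(_ _ fkj)[].
  by case: nfj; have := fEmono k (n - k)%N; rewrite subnKC ?(ltnW kn)//; exact.
have [|J [fJ' JBB JP]] := @cover E (e / 4) EA; first by lra.
have JB n : exists B, [/\ J B, ~ (f n).1.2 B & (f n.+1).1.2 B].
  have [y [B [[BBB nB B1 yB] [_ [vy ey]]]]] := fstep n.
  exists B; split=> //.
  have mE : m y E = m y (f n.+1).2.
    rewrite (@faD _ _ y E (f n.+1).2); last by move=> j ?; exists n.+1.
    suff -> : m y (E `\` (f n.+1).2) = 0 by rewrite addr0.
    by apply: fa_eq0 vy; exact: Ediff.
  have [B' JB' yB'] := JP y (ltac:(by rewrite mE)).
  suff -> : B = B' by [].
  apply: contrapT => BB'; have := aBB _ _ BBB (JBB _ JB') BB'.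
  exact: star_infinite (starI yB yB').
have [g gP] := choice JB.
have ginj : injective g.
  have lt_neq a b : (a < b)%N -> g a <> g b.
    move=> ab gab; have [_ _ ga] := gP a; have [_ + _] := gP b.
    by rewrite -gab; apply; rewrite -(subnKC ab); exact: fJ ga.
  move=> a b gab; case: (ltngtP a b) => // ab.
    by case: (lt_neq _ _ ab).
  by case: (lt_neq _ _ ab).
apply: infinite_nat; apply: (@sub_finite_set _ _ (g @^-1` J)).
  by move=> n _; have [] := gP n.
by apply: finite_preimage => // ? ? _ _; exact: ginj.
Qed.

Definition variation_stable (A : set nat) (s : R) :=
  (forall y, fa_var m y A <= s) /\
  forall A', infinite_set A' -> A' `<=` A ->
    forall t, t < s -> exists y, t < fa_var m y A'.

Definition full_variation_on (A B : set nat) (s : R) :=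
  forall A', infinite_set A' -> A' `<=` A ->
    forall t, t < s -> exists2 y, star B y & t < fa_var m y A'.

(** Treat the members of l one by one: if B does not have full variation below
    the current set, a smaller set bounds the variation on B^* away from s. *)
Lemma full_or_small (s : R) (l : seq (set nat)) (A : set nat) :
  0 < s -> infinite_set A ->
  exists A', [/\ infinite_set A', A' `<=` A &
    (exists2 B, B \in l & full_variation_on A' B s) \/
    (exists2 t, t < s & forall B y, B \in l -> star B y -> fa_var m y A' <= t)].
Proof.
move=> s0 iA; elim: l => [|B l [A1 [iA1 A1A [[B' B'l gB']|[t ts tl]]]]].
- by exists A; split=> //; right; exists 0.
- by exists A1; split=> //; left; exists B' => //; rewrite in_cons B'l orbT.
have [gB|] := pselect (full_variation_on A1 B s).
  by exists A1; split=> //; left; exists B => //; rewrite mem_head.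
move=> /existsNP[A2] /not_implyP[iA2] /not_implyP[A21] /existsNP[t'].
move=> /not_implyP[t's nt']; exists A2; split=> //; first exact: subset_trans A1A.
right; exists (Num.max t t'); first by rewrite gt_max ts t's.
move=> B' y; rewrite in_cons le_max => /predU1P[->|B'l] yB.
  apply/orP; right; rewrite leNgt; apply/negP => ty; apply: nt'; by exists y.
by apply/orP; left; exact: le_trans (fa_varS _ _ A21) (tl B' y B'l yB).
Qed.

Definition vanishes_on_nowhere_dense := forall F, nowhere_dense F ->
  forall A, infinite_set A -> exists A', [/\ A' `<=` A, infinite_set A' &
    forall y, F y -> fa_var m y A' = 0].

(** All variation above s/2 sits on finitely many members of a maximal almost
    disjoint subfamily of D, and stability forbids that each of them stays
    below some t < s. *)
Lemma full_variation_in_dense (D : set (set nat)) (A : set nat) (s : R) :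
  vanishes_on_nowhere_dense -> dense_family D ->
  infinite_set A -> 0 < s -> variation_stable A s ->
  exists A' B, [/\ A' `<=` A, infinite_set A', D B & full_variation_on A' B s].
Proof.
move=> mF /maximal_almost_disjoint[BB [BD aBB BBd]] iA s0 [sA As].
have [A1 [A1A iA1 mA1]] := mF _ (nowhere_dense_remainder BBd) A iA.
have s20 : 0 < s / 2 by lra.
have [|A2 [J [A21 iA2 fJ JBB JP]]] := small_off_finitely_many aBB iA1 s20.
  by move=> y nB; apply: mA1 => -[B BBB yB]; exact: nB yB.
have /finite_seqP[l Jl] := fJ.
have [A3 [iA3 A32 [[B Bl gB]|[t ts tl]]]] := full_or_small l s0 iA2.
  exists A3, B; split=> //.
    exact: subset_trans (subset_trans A32 A21) A1A.
  by apply: BD; apply: JBB; rewrite Jl.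
have [||y] := As A3 iA3 _ (Num.max t (s / 2)).
- exact: subset_trans (subset_trans A32 A21) A1A.
- by rewrite gt_max ts; lra.
rewrite gt_max => /andP[ty sy]; exfalso.
have [[B JB yB]|nB] := pselect (exists2 B, J B & star B y).
  by move: ty; rewrite ltNge => /negP; apply; apply: (tl B) => //; move: JB; rewrite Jl.
move: sy; rewrite ltNge => /negP; apply.
by rewrite (le_trans (fa_varS _ _ A32))// JP// => B JB yB; apply: nB; exists B.
Qed.

End full_variation.

(** * Pairs on which the set functions are two-valued *)

Section two_valued.
Context {R : realType} (m : fa_kernel R).

Lemma exists_variation_stable (c : R) (A : set nat) : 0 < c ->
  (forall A', infinite_set A' -> exists y, c <= fa_var m y A') ->
  infinite_set A ->
  exists A0 s, [/\ A0 `<=` A, infinite_set A0, 0 < s & variation_stable m A0 s].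
Proof.
move=> c0 mc iA; pose s (A' : set nat) := sup (range (fun y => fa_var m y A')).
have [M mM] := fa_var_bounded m.
have hs A' : has_sup (range (fun y => fa_var m y A')).
  split; first by exists (fa_var m Nstar_point A'), Nstar_point.
  by exists M => _ [y _ <-].
have sub A' y : fa_var m y A' <= s A'.
  by apply: ub_le_sup; [exact: (hs A').2|exists y].
have [||A0 [iA0 A0A sA0]] := @constant_below _ s _ _ A iA.
- move=> B C _ fBC; apply: ge_sup; first exact: (hs B).1.
  by move=> _ [y _ <-]; exact: le_trans (fa_var_almostS m y fBC) (sub _ _).
- by exists 0 => B _; exact: le_trans (fa_var_ge0 m Nstar_point B) (sub _ _).
exists A0, (s A0); split=> //.
  by have [y cy] := mc _ iA0; exact: lt_le_trans c0 (le_trans cy (sub _ _)).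
split=> [y|A' iA' A'A0 t]; first exact: sub.
rewrite -(sA0 _ iA' A'A0) => /sup_gt[|_ [y _ <-] ty]; first exact: (hs A').1.
by exists y.
Qed.

(** The variation of m_y on A cannot be split, i.e. m_y restricted to A is a
    multiple of a point mass. *)
Definition pure_on (A B : set nat) := forall y C, star B y -> C `<=` A ->
  fa_var m y C = 0 \/ fa_var m y (A `\` C) = 0.

(** Shrink B until the supremum of m_y(A) over y in B^* no longer depends on B;
    a smaller value at one point would persist on a neighbourhood. *)
Lemma locally_constant (A B : set nat) : infinite_set B ->
  exists B0 r, [/\ B0 `<=` B, infinite_set B0 & forall y, star B0 y -> m y A = r].
Proof.
move=> iB; have [M mM] := fa_bounded m.
pose s (B' : set nat) := sup [set m y A | y in star B'].
have ubs B' : has_ubound [set m y A | y in star B'].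
  by exists M => _ [y _ <-]; exact: le_trans (ler_norm _) (mM y A).
have sub B' y : star B' y -> m y A <= s B'.
  by move=> yB'; apply: ub_le_sup => //; exists y.
have slub B' t : infinite_set B' -> (forall y, star B' y -> m y A <= t) -> s B' <= t.
  move=> /star_nonempty[y yB'] mt; apply: ge_sup; first by exists (m y A), y.
  by move=> _ [z zB' <-]; exact: mt.
have [||B0 [iB0 B0B sB0]] := @constant_below _ s _ _ B iB.
- move=> B1 B2 iB1 fB; apply: slub => // y yB1; apply: sub.
  exact: star_almostS fB _ yB1.
- exists (- M) => B1 /star_nonempty[y yB1]; apply: le_trans (sub _ _ yB1).
  by have := mM y A; rewrite ler_norml => /andP[].
exists B0, (s B0); split=> // y yB0; apply/eqP; rewrite eq_le sub//=.
rewrite leNgt; apply/negP => ys; pose t := (m y A + s B0) / 2.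
have yt : m y A < t by rewrite /t; lra.
have ts : t < s B0 by rewrite /t; lra.
have /nbhs_star[E yE EC] : nbhs y [set z | m z A < t].
  exact: (cvgr_lt _ (@fa_continuous _ m A y) _ yt).
have yBE := starI yB0 yE.
move: ts; rewrite -(sB0 _ (star_infinite yBE) (@subIsetl _ _ _)) ltNge => /negP; apply.
apply: slub => [|z zBE]; first exact: star_infinite yBE.
by apply: ltW; apply: EC; apply: starS zBE; exact: subIsetr.
Qed.

Definition spread_over (A B : set nat) := exists C d, [/\ C `<=` A, 0 < d &
  forall y, star B y -> d <= fa_var m y C /\ d <= fa_var m y (A `\` C)].

(** When the m_y, y in B^*, are multiples of point masses at psi(y), this says
    that the image of B^* under psi is nowhere dense. *)
Definition nowhere_charging (A B : set nat) := forall A2, A2 `<=` A ->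
  infinite_set A2 -> exists A3, [/\ A3 `<=` A2, infinite_set A3 &
    forall y, star B y -> m y A3 = 0].

(** If purity fails at one point of B^*, lower semicontinuity spreads the two
    positive masses over a neighbourhood. Otherwise pass to a set where m_y(A)
    is constant and, when there is one, to a subset whose image is nowhere
    dense. *)
Lemma dense_dichotomy (A : set nat) : dense_family (fun B =>
  spread_over A B \/ exists r, [/\ pure_on A B, forall y, star B y -> m y A = r &
    nowhere_charging A B \/
    forall B2, B2 `<=` B -> infinite_set B2 -> ~ nowhere_charging A B2]).
Proof.
move=> B iB; have [pAB|] := pselect (pure_on A B); last first.
  move=> /existsNP[y] /existsNP[C] /not_implyP[yB] /not_implyP[CA] /not_orP[v1 v2].
  have v10 : 0 < fa_var m y C by rewrite lt_neqAle fa_var_ge0 andbT eq_sym; exact/eqP.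
  have v20 : 0 < fa_var m y (A `\` C).
    by rewrite lt_neqAle fa_var_ge0 andbT eq_sym; exact/eqP.
  pose d := Num.min (fa_var m y C) (fa_var m y (A `\` C)) / 2.
  have d0 : 0 < d by rewrite /d divr_gt0// lt_min v10.
  have d1 : d < fa_var m y C.
    have : Num.min (fa_var m y C) (fa_var m y (A `\` C)) <= fa_var m y C by rewrite ge_min lexx.
    by rewrite /d; lra.
  have d2 : d < fa_var m y (A `\` C).
    have : Num.min (fa_var m y C) (fa_var m y (A `\` C)) <= fa_var m y (A `\` C).
      by rewrite ge_min lexx orbT.
    by rewrite /d; lra.
  have [E1 yE1 E1P] := fa_var_lsc d1; have [E2 yE2 E2P] := fa_var_lsc d2.
  have yE := starI yB (starI yE1 yE2).
  exists (B `&` (E1 `&` E2)); split; [exact: subIsetl|exact: star_infinite yE|left].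
  exists C, d; split=> // z zE; split; apply: ltW; [apply: E1P|apply: E2P].
    by apply: starS zE => n [_ []].
  by apply: starS zE => n [_ []].
have [B0 [r [B0B iB0 rB0]]] := locally_constant A iB.
have pS B' : B' `<=` B -> pure_on A B'.
  by move=> B'B y C /(starS B'B); exact: pAB.
have [[B1 [B1B0 iB1 nB1]]|nB] := pselect (exists B1, [/\ B1 `<=` B0, infinite_set B1 & nowhere_charging A B1]).
  exists B1; split=> //; first exact: subset_trans B0B.
  right; exists r; split=> //; [|by move=> y /(starS B1B0); exact: rB0|by left].
  by apply: pS; exact: subset_trans B0B.
exists B0; split=> //; right; exists r; split=> //; first exact: pS.
by right=> B2 B20 iB2 nB2; apply: nB; exists B2.
Qed.

Lemma pure_valued (A B : set nat) (r : R) y C :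
  pure_on A B -> star B y -> m y A = r -> C `<=` A ->
  (fa_var m y C != 0 /\ m y C = r /\ fa_var m y (A `\` C) = 0) \/
  (fa_var m y C = 0 /\ m y C = 0).
Proof.
move=> pAB yB mr CA.
have v0 D := @fa_eq0 _ m y D D (@subset_refl _ D).
have [vC|vC] := eqVneq (fa_var m y C) 0; first by right; split=> //; exact: v0.
left; have [/eqP|vAC] := pAB y C yB CA; first by rewrite (negbTE vC).
by split=> //; split=> //; rewrite -mr (faD m y CA) (v0 _ vAC) addr0.
Qed.

(** Full variation s on B^* rules out a uniform splitting of A, because A1 meets
    one of the two pieces in an infinite set, and rules out [nowhere_charging]
    since it makes every infinite subset of A1 charged at some y in B^*. The
    set B is then cut down to the points where the mass r sits on A1, a clopen
    condition. *)
Lemma pure_pair (c : R) (A : set nat) : 0 < c ->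
  (forall A', infinite_set A' -> exists y, c <= fa_var m y A') ->
  vanishes_on_nowhere_dense m -> infinite_set A ->
  exists A1 B r, [/\ A1 `<=` A, infinite_set A1, infinite_set B & r != 0] /\
    [/\ forall y C, star B y -> C `<=` A1 -> m y C = 0 \/ m y C = r,
        forall y, star B y -> m y A1 = r,
        forall A2, A2 `<=` A1 -> infinite_set A2 -> exists2 y, star B y & m y A2 = r &
        forall B2, B2 `<=` B -> infinite_set B2 ->
          exists A2, [/\ A2 `<=` A1, infinite_set A2 &
            forall A3, A3 `<=` A2 -> infinite_set A3 ->
              exists2 y, star B2 y & m y A3 = r]].
Proof.
move=> c0 mc mF iA.
have [A0 [s [A0A iA0 s0 [sA sA0]]]] := exists_variation_stable c0 mc iA.
have [A1 [B [A10 iA1 dB fB]]] :=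
  full_variation_in_dense mF (dense_dichotomy A0) iA0 s0 (conj sA sA0).
case: dB => [[C [d [CA0 d0 dC]]]|[r [pB rB charge]]].
  exfalso.
  have sd : s - d < s by lra.
  have aux A2 : infinite_set (A1 `&` A2) -> (forall y, star B y -> fa_var m y A2 <= s - d) -> False.
    move=> iA2 vA2; have [y yB] := fB _ iA2 (@subIsetl _ _ _) _ sd.
    by rewrite ltNge (le_trans (fa_varS _ _ (@subIsetr _ _ _)))// vA2.
  have [fC|iC] := pselect (finite_set (A1 `&` C)).
    apply: (aux (A0 `\` C)).
      apply: infinite_setS (infinite_setD fC iA1) => n [A1n nAC]; split=> //; split.
        exact: A10.
      by move=> Cn; apply: nAC.
    by move=> y /dC[d1 _]; have := sA y; rewrite (fa_varD m y CA0); lra.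
  by apply: (aux C) => // y /dC[_ d2]; have := sA y; rewrite (fa_varD m y CA0); lra.
have A0S C : C `<=` A1 -> C `<=` A0 by move=> /subset_trans; exact.
have val y C yB CA1 := pure_valued pB yB (rB y yB) (A0S C CA1).
have m0r y C : star B y -> C `<=` A1 -> m y C = 0 \/ m y C = r.
  by move=> yB CA1; have [[_ []]|[]] := val y C yB CA1; [right|left].
have hit C : C `<=` A1 -> infinite_set C ->
    exists2 y, star B y & m y C = r /\ m y A1 = r.
  move=> CA1 iC; have [y yB vC] := fB C iC CA1 0 s0; exists y => //.
  have vA1 : 0 < fa_var m y A1 := lt_le_trans vC (fa_varS m y CA1).
  split.
    by have [[_ []]|[vC0]] := val y C yB CA1 => //; rewrite vC0 ltxx in vC.
  have [[_ []]|[vA0]] := val y A1 yB (@subset_refl _ _) => //.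
  by rewrite vA0 ltxx in vA1.
have r0 : r != 0.
  apply/eqP => r0; have [y yB] := fB A1 iA1 (@subset_refl _ _) 0 s0.
  by rewrite fa_var_eq0 ?ltxx// => C /(m0r y C yB)[]//; rewrite r0.
(* The points of B^* that psi sends into A1^*. *)
pose U := star B `&` [set y | m y A1 = r].
have [y|B1 UB1] := @locally_decided_star U.
  have [yB|/starC ynB] := pselect (star B y); last first.
    by exists (~` B) => //; right=> z /starC znB [].
  have /nbhs_star[E yE EP] : nbhs y [set z | `|m y A1 - m z A1| < `|r|].
    have rpos : 0 < `|r| by rewrite normr_gt0.
    exact: ((cvgrPdist_lt _ _).1 (@fa_continuous _ m A1 y) _ rpos).
  exists (B `&` E); first exact: starI.
  have same z : star (B `&` E) z -> star B z /\ m z A1 = m y A1.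
    move=> zBE; have zB : star B z by apply: starS zBE; exact: subIsetl.
    split=> //; have /EP/= : star E z by apply: starS zBE; exact: subIsetr.
    have [->|->] := m0r z A1 zB (@subset_refl _ _);
      have [->|->] := m0r y A1 yB (@subset_refl _ _) => //.
      by rewrite subr0 ltxx.
    by rewrite sub0r normrN ltxx.
  have [yr|yr] := pselect (m y A1 = r); [left|right] => z /same[zB zy].
    by split=> //=; rewrite zy.
  by move=> [_ /=]; rewrite zy.
have B1P y : star B1 y -> star B y /\ m y A1 = r by rewrite -UB1.
exists A1, B1, r; split; first split=> //.
- exact: subset_trans A0A.
- have [y yB [_ yr]] := hit A1 (@subset_refl _ _) iA1.
  by apply: (@star_infinite _ y); rewrite -UB1.
split.
- by move=> y C /B1P[yB _]; exact: m0r.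
- by move=> y /B1P[].
- move=> A2 A21 iA2; have [y yB [mA2 mA1]] := hit A2 A21 iA2.
  by exists y => //; rewrite -UB1.
move=> B2 B21 iB2; case: charge => [/(_ A1 A10 iA1)[A3 [A31 iA3 mA3]]|].
  exfalso; have [y yB [mA3r _]] := hit A3 A31 iA3.
  by move: r0; rewrite -mA3r mA3// eqxx.
have iB2B : infinite_set (B `&` B2).
  have [y yB2] := star_nonempty iB2.
  by have /B1P[yB _] := starS B21 yB2; exact: star_infinite (starI yB yB2).
move=> /(_ _ (@subIsetl _ _ _) iB2B)/existsNP[A2]/not_implyP[A20].
move=> /not_implyP[iA2 nA2].
have charged A3 : A3 `<=` A2 -> infinite_set A3 ->
    exists y, [/\ star B2 y, star B y, m y A1 = r & m y A3 <> 0].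
  move=> A32 iA3; apply: contrapT => ny; apply: nA2; exists A3; split=> // y yBB.
  have yB2 : star B2 y by apply: starS yBB; exact: subIsetr.
  have /B1P[yB yr] := starS B21 yB2.
  by apply: contrapT => yA3; apply: ny; exists y.
have iA21 : infinite_set (A2 `&` A1).
  move=> fA21; have iD : infinite_set (A2 `\` A1).
    by apply: infinite_setS (infinite_setD fA21 iA2) => n [A2n nA]; split=> // A1n; apply: nA.
  have [y [_ yB mA1]] := charged _ (@subDsetl _ _ _) iD; apply.
  have [[_ [_ vA]]|[_ mA1']] := val y A1 yB (@subset_refl _ _); last first.
    by move: r0; rewrite -mA1 mA1' eqxx.
  by apply: fa_eq0 vA; exact: setSD.
exists (A2 `&` A1); split=> // A3 A321 iA3.
have A32 : A3 `<=` A2 by apply: subset_trans A321 _; exact: subIsetl.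
have A31 : A3 `<=` A1 by apply: subset_trans A321 _; exact: subIsetr.
have [y [yB2 yB _ nA3]] := charged A3 A32 iA3; exists y => //.
by have [|] := m0r y A3 yB A31.
Qed.

End two_valued.

(** * From operators to set functions and back *)

Section functions.
Context {R : realType}.
Implicit Types f g h : cspace R Nstar.

Lemma cspace_ext f g : (forall y, f y = g y) -> f = g.
Proof. by move=> fg; apply: val_inj; apply/funext => y; exact: fg. Qed.

Lemma cspaceDE f g y : (f + g) y = f y + g y. Proof. by []. Qed.
Lemma cspaceZE a f y : (a *: f) y = a * f y. Proof. by []. Qed.

Lemma cspace_nbhs f y e : 0 < e ->
  exists2 E, star E y & forall z, star E z -> `|f y - f z| < e.
Proof.
move=> e0; apply/nbhs_star.
exact: ((cvgrPdist_lt _ _).1 (@cts_fun _ _ f y) _ e0).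
Qed.

Lemma cspace_bounded f : exists K, forall y, `|f y| <= K.
Proof.
have [||y|E [K EK] fE] :=
    @Nstar_exhaust (fun E => exists K, forall y, star E y -> `|f y| <= K).
- by exists 0 => y /star_infinite/(_ (finite_set0 _)).
- move=> E E' [K EK] [K' EK']; exists (Num.max K K') => y /starU[/EK|/EK'].
    by rewrite le_max => ->.
  by rewrite le_max => ->; rewrite orbT.
- have [E yE EP] := cspace_nbhs f y (@ltr01 R); exists E => //.
  exists (`|f y| + 1) => z /EP; have := lerB_normD (f z) (f y - f z).
  by rewrite addrCA subrr addr0 => *; lra.
- exists K => y; apply: EK.
  exact: star_cofinite.
Qed.

Lemma sup_norm_ub f y : `|f y| <= sup_norm f.
Proof.
have [K fK] := cspace_bounded f.
by apply: ub_le_sup; [exists K => _ [z _ <-]|exists y].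
Qed.

Lemma sup_norm_lub f t : (forall y, `|f y| <= t) -> sup_norm f <= t.
Proof.
move=> ft; apply: ge_sup; first by exists `|f Nstar_point|, Nstar_point.
by move=> _ [z _ <-].
Qed.

Lemma indic_star_continuous A : continuous (\1_(star A) : Nstar -> R).
Proof.
move=> y U /nbhs_singleton Uy.
suff [E yE EA] : exists2 E, star E y &
    forall z, star E z -> \1_(star A) z = \1_(star A) y :> R.
  by apply/nbhs_star; exists E => // z /EA /= ->.
have [yA|/starC ynA] := pselect (star A y).
  by exists A => // z zA; rewrite !indicE !mem_set.
exists (~` A) => // z /starC znA; rewrite !indicE !memNset//; exact/starC.
Qed.

Definition indic_star A : cspace R Nstar := mkcts (@indic_star_continuous A).

Lemma indic_starT A y : star A y -> indic_star A y = 1.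
Proof. by move=> yA; rewrite -[LHS]/(\1_(star A) y) indicE mem_set. Qed.

Lemma indic_starF A y : ~ star A y -> indic_star A y = 0.
Proof. by move=> yA; rewrite -[LHS]/(\1_(star A) y) indicE memNset. Qed.

Lemma indic_starU A B : A `&` B = set0 ->
  indic_star (A `|` B) = indic_star A + indic_star B.
Proof.
move=> AB; apply: cspace_ext => y; rewrite cspaceDE.
have [yA|yA] := pselect (star A y); have [yB|yB] := pselect (star B y).
- have := starI yA yB; rewrite AB => /star_infinite/(_ (finite_set0 _)) [].
- by rewrite (indic_starT yA) (indic_starF yB) addr0 indic_starT//; apply/starU; left.
- by rewrite (indic_starF yA) (indic_starT yB) add0r indic_starT//; apply/starU; right.
- by rewrite (indic_starF yA) (indic_starF yB) addr0 indic_starF// => /starU[].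
Qed.

(** A function supported by A^* is uniformly approximated by combinations of
    indicators of subsets of A. The induction over a cover by sets of small
    oscillation asks for an approximation on every part D of the covered set,
    so that two covered sets can be made disjoint before adding. *)
Lemma bounded_functional_eq0 (l : cspace R Nstar -> R) (A : set nat) h :
  (forall a f g, l (a *: f + g) = a * l f + l g) ->
  (exists K, forall f t, (forall y, `|f y| <= t) -> `|l f| <= K * t) ->
  (forall C, C `<=` A -> l (indic_star C) = 0) ->
  (forall y, ~ star A y -> h y = 0) -> l h = 0.
Proof.
move=> lin [K lK] lA hA.
have l0 : l 0 = 0 by have := lin 1 0 0; rewrite scaler0 addr0; lra.
have lD f g : l (f + g) = l f + l g by rewrite -[f]scale1r lin scale1r mul1r.
have lZ a f : l (a *: f) = a * l f by rewrite -[a *: f]addr0 lin l0 addr0.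
suff app e : 0 < e -> exists g, l g = 0 /\ forall y, `|(h - g) y| <= e.
  apply/eqP; rewrite -normr_le0; apply/ler_addgt0Pl => e e0; rewrite addr0.
  have K1 : 0 < `|K| + 1 by rewrite ltr_wpDl.
  have [g [lg hg]] := app (e / (`|K| + 1)) (divr_gt0 e0 K1).
  have -> : l h = l (h - g) by rewrite -scaleN1r lD lZ lg mulr0 addr0.
  apply: le_trans (lK _ _ hg) _; rewrite mulrA ler_pdivrMr// mulrC ler_pM2l//.
  by have := ler_norm K; lra.
move=> e0.
have [||y|E EP fE] := @Nstar_exhaust (fun E => forall D, D `<=` E -> D `<=` A ->
    exists g, [/\ l g = 0, forall y, star D y -> `|h y - g y| <= e &
      forall y, ~ star D y -> g y = 0]).
- move=> D D0 _; exists 0; split=> // y /star_infinite; rewrite subset0 in D0.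
  by rewrite D0 => /(_ (finite_set0 _)).
- move=> E E' EP EP' D DE DA.
  have [g [lg gD gnD]] := EP _ (@subIsetr _ D E) (subset_trans (@subIsetl _ D E) DA).
  have [|g' [lg' gD' gnD']] := EP' (D `\` E) _ (subset_trans (@subDsetl _ D E) DA).
    by move=> n [/DE[]].
  exists (g + g'); split; first by rewrite lD lg lg' addr0.
    move=> y yD; rewrite cspaceDE; have [yE|nyE] := pselect (star E y).
      rewrite gnD' ?addr0; first by apply: gD; exact: starI.
      by move=> yDE; have : star (~` E) y by [apply: starS yDE; exact: subDsetr]; move=> /starC.
    rewrite gnD ?add0r; last by move=> yDE; apply: nyE; apply: starS yDE; exact: subIsetr.
    by apply: gD'; apply: starI => //; exact/starC.
  move=> y nyD; rewrite cspaceDE gnD ?gnD' ?addr0//.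
    by move=> yDE; apply: nyD; apply: starS yDE; exact: subDsetl.
  by move=> yDE; apply: nyD; apply: starS yDE; exact: subIsetl.
- have [E yE EP] := cspace_nbhs h y e0; exists E => // D DE DA.
  exists (h y *: indic_star D); split; first by rewrite lZ lA ?mulr0.
    move=> z zD; rewrite cspaceZE indic_starT// mulr1 distrC ltW//.
    by apply: EP; exact: starS zD.
  by move=> z zD; rewrite cspaceZE indic_starF// mulr0.
have [g [lg gA gnA]] := EP (E `&` A) (@subIsetl _ _ _) (@subIsetr _ _ _).
have EA y : star (E `&` A) y <-> star A y.
  split; first by apply: starS; exact: subIsetr.
  move=> yA; apply: starI => //.
  exact: star_cofinite.
exists g; split=> // y; rewrite -[(h - g) y]/(h y - g y).
have [/EA|nyA] := pselect (star A y); first exact: gA.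
by rewrite hA// gnA ?subrr ?normr0 ?ltW// => /EA.
Qed.

End functions.

Section operator.
Context {R : realType} (T : {linear cspace R Nstar -> cspace R Nstar}).

Lemma bounded_operator_norm : bounded_operator T ->
  exists K, forall (f : cspace R Nstar) t y,
    (forall z, `|f z| <= t) -> `|T f y| <= K * t.
Proof.
move=> [M TM]; exists `|M| => f t y ft.
apply: le_trans (sup_norm_ub _ _) (le_trans (TM f) _).
have s0 : 0 <= sup_norm f := le_trans (normr_ge0 _) (sup_norm_ub f y).
apply: le_trans (ler_wpM2r s0 (ler_norm M)) _.
by rewrite ler_wpM2l//; exact: sup_norm_lub.
Qed.

Lemma norm_indic_star A y : `|(indic_star A : cspace R Nstar) y| <= 1.
Proof.
have [yA|yA] := pselect (star A y).
  by rewrite indic_starT// normr1.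
by rewrite indic_starF// normr0.
Qed.

Context (T_bounded : bounded_operator T).

Definition operator_kernel : fa_kernel R.
Proof.
refine (@FaKernel R (fun y A => T (indic_star A) y) _ _ _ _).
- by move=> y A B AB; rewrite indic_starU// linearD.
- move=> y A fA; suff -> : indic_star A = 0 :> cspace R Nstar by rewrite linear0.
  by apply: cspace_ext => z; rewrite indic_starF// => /star_infinite.
- have [K TK] := bounded_operator_norm T_bounded.
  by exists (K * 1) => y A; apply: TK => z; exact: norm_indic_star.
- by move=> A; exact: cts_fun.
Defined.

(** The bounded S maps T(1_{A^*}) back to 1_{A^*}, which has norm 1, so
    T(1_{A^*}) cannot be small. *)
Lemma operator_kernel_lower (S : cspace R Nstar -> cspace R Nstar) :
  cancel T S -> bounded_operator S ->
  exists2 c : R, 0 < c & forall A, infinite_set A ->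
    exists y, c <= fa_var operator_kernel y A.
Proof.
move=> TS [K SK]; have K1 : 0 < `|K| + 1 by rewrite ltr_wpDl.
exists (`|K| + 1)^-1; first by rewrite invr_gt0.
move=> A iA; apply: contrapT => nc; have [y yA] := star_nonempty iA.
have Tc : sup_norm (T (indic_star A)) <= (`|K| + 1)^-1.
  apply: sup_norm_lub => z; rewrite leNgt; apply/negP => cz; apply: nc.
  exists z; apply: le_trans (ltW cz) _.
  exact: (fa_norm_le operator_kernel z A).
have := SK (T (indic_star A)); rewrite TS; apply/negP; rewrite -ltNge.
have s0 : 0 <= sup_norm (T (indic_star A)) :=
  le_trans (normr_ge0 _) (sup_norm_ub _ y).
apply: (@lt_le_trans _ _ 1); last first.
  by have := sup_norm_ub (indic_star A : cspace R Nstar) y; rewrite indic_starT// normr1.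
apply: le_lt_trans (ler_wpM2r s0 (ler_norm K)) _.
apply: le_lt_trans (ler_wpM2l (normr_ge0 K) Tc) _.
by rewrite ltr_pdivrMr// mul1r ltrDl.
Qed.

Lemma charge_integral_indic_star (mu : {charge set borel Nstar -> \bar R}) G A :
  concentrated mu G -> star A `<=` ~` G -> charge_integral mu (indic_star A) = 0.
Proof.
move=> [N [mN vN GN]] AG.
have mA : measurable (star A : set (borel Nstar)).
  by apply: sub_sigma_algebra; exact: star_open.
have AN : (star A : set (borel Nstar)) `<=` N by exact: subset_trans AG GN.
have : (jordan_pos (hahn_posneg mu) N == 0) && (jordan_neg (hahn_posneg mu) N == 0).
  by rewrite -padde_eq0 ?measure_ge0//; exact/eqP.
move=> /andP[/eqP pN /eqP nN].
rewrite /charge_integral /Rintegral.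
have int0 (nu : {measure set borel Nstar -> \bar R}) :
    nu N = 0%E -> (\int[nu]_x (indic_star A x : R)%:E = 0)%E.
  move=> nuN; rewrite (integral_indic nu measurableT mA) setIT.
  exact: (subset_measure0 mA mN AN nuN).
by rewrite !int0// subrr.
Qed.

(** The closure of the nowhere dense G given by the funnelless property misses
    some clopen set inside A^*, and a measure concentrated on G gives that set
    no mass. *)
Lemma operator_kernel_vanishes : funnelless T ->
  vanishes_on_nowhere_dense operator_kernel.
Proof.
move=> fT F /fT[G ndG GT] A iA.
have [y yA nyG] : exists2 y, star A y & ~ closure G y.
  apply: contrapT => nA; have [y yA] := star_nonempty iA.
  have : interior (closure G) y.
    apply/nbhs_star; exists A => // z zA; apply: contrapT => nzG.
    by apply: nA; exists z.
  by rewrite ndG.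
have : nbhs y (~` closure G).
  by apply: open_nbhs_nbhs; split=> //; rewrite openC; exact: closed_closure.
move=> /nbhs_star[E yE EG].
exists (A `&` E); split; [exact: subIsetl|exact: star_infinite (starI yA yE)|].
move=> z Fz; apply: fa_var_eq0 => C CAE; have [mu [_ muT] muG] := GT z Fz.
rewrite -[LHS]/(adjoint T (dirac_functional z) (indic_star C)) muT.
apply: charge_integral_indic_star muG _ => x xC xG; apply: (EG x).
  by apply: starS xC => n /CAE[].
exact: subset_closure.
Qed.

End operator.

(** * The canonical map *)

Section canonical_map.
Context {R : realType} (m : fa_kernel R) (A B : set nat) (r : R).
Context (r0 : r != 0)
  (m0r : forall y C, star B y -> C `<=` A -> m y C = 0 \/ m y C = r)
  (mA : forall y, star B y -> m y A = r).

Let m0S y C D : star B y -> C `<=` D -> D `<=` A -> m y D = 0 -> m y C = 0.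
Proof.
move=> yB CD DA mD; have CA := subset_trans CD DA.
have DCA : D `\` C `<=` A by move=> n [/DA].
have := faD m y CD; rewrite mD; move: r0.
have [//|->] := m0r yB CA.
by have [->|->] := m0r yB DCA => /eqP; lra.
Qed.

Let mrS y C D : star B y -> C `<=` D -> D `<=` A -> m y C = r -> m y D = r.
Proof.
move=> yB CD DA mC; have [/(m0S yB CD DA)|//] := m0r yB DA.
by rewrite mC => rr; move: r0; rewrite rr eqxx.
Qed.

(** A two-valued finitely additive function on the subsets of A is an
    ultrafilter; it is nonprincipal as finite sets have mass 0. *)
Lemma support_point y : star B y ->
  exists x : Nstar, forall C, star C x <-> m y (C `&` A) = r.
Proof.
move=> yB.
have split_r C : C `<=` A -> m y C = r -> m y (A `\` C) = 0.
  by move=> CA mC; have := faD m y CA; rewrite mC mA//; lra.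
apply: (@Nstar_of_family (fun C => m y (C `&` A) = r)).
- by rewrite setTI mA.
- move=> C D mC mD.
  have [CD0|//] := m0r yB (@subIsetr _ (C `&` D) A).
  have mCD : m y (C `&` A `\` D) = 0.
    apply: (m0S yB _ (@subDsetl _ A (D `&` A))).
      by move=> n [[Cn An] nD]; split=> // -[].
    by apply: split_r => //; exact: subIsetr.
  have := @faD _ m y (C `&` A) (C `&` D `&` A).
  have -> : (C `&` A) `\` (C `&` D `&` A) = (C `&` A) `\` D.
    apply/seteqP; split=> n /=; first by move=> [[Cn An] h]; split=> // Dn; apply: h.
    by move=> [[Cn An] h]; split=> // -[[]].
  rewrite mCD CD0 addr0 mC => -> // n [[Cn Dn] An]; by split.
- by move=> C D CD; apply: mrS => //; exact: setSI.
- move=> C; have [C0|] := m0r yB (@subIsetr _ C A); last by left.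
  right; have := @faD _ m y A (C `&` A) (@subIsetr _ _ _).
  rewrite C0 add0r mA// => ->; congr (m y _).
  by apply/seteqP; split=> n /=; tauto.
- move=> C fC; rewrite fa_finite; last by apply: sub_finite_set fC => n [].
  by move=> rr; move: r0; rewrite rr eqxx.
Qed.

Lemma exists_canonical_map : exists psi : star B -> star A,
  forall y C, star C (val (psi y)) <-> m (val y) (C `&` A) = r.
Proof.
have pt (y : star B) : exists x : star A,
    forall C, star C (val x) <-> m (val y) (C `&` A) = r.
  have yB : star B (val y) := set_mem (valP y).
  have [x xP] := support_point yB.
  have xA : star A x by apply/xP; rewrite setIid mA.
  by exists (exist _ x (mem_set xA)).
by have [psi psiP] := choice pt; exists psi.
Qed.

Context (psi : star B -> star A)
  (psiP : forall y C, star C (val (psi y)) <-> m (val y) (C `&` A) = r).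

Let mloc (y : star B) C : exists2 E, star E (val y) &
  forall z : star B, star E (val z) -> m (val z) (C `&` A) = m (val y) (C `&` A).
Proof.
have rpos : 0 < `|r| by rewrite normr_gt0.
have /nbhs_star[E yE EP] : nbhs (val y)
    [set z | `|m (val y) (C `&` A) - m z (C `&` A)| < `|r|].
  exact: ((cvgrPdist_lt _ _).1 (@fa_continuous _ m (C `&` A) (val y)) _ rpos).
exists E => // z /EP/=.
have [->|->] := m0r (set_mem (valP z)) (@subIsetr _ C A);
  have [->|->] := m0r (set_mem (valP y)) (@subIsetr _ C A) => //.
  by rewrite subr0 ltxx.
by rewrite sub0r normrN ltxx.
Qed.

Lemma canonical_map_continuous : continuous psi.
Proof.
move=> y U /nbhs_star_sub[C yC CU]; apply/nbhs_star_sub.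
have [E yE EP] := mloc y C; exists E => // z /EP mz; apply: CU => /=.
by apply/psiP; rewrite mz; exact/psiP.
Qed.

(** Points reached for every infinite subset of A2 give all points of A2^*, by
    compactness: if x were missed, each y would have a neighbourhood on
    whose part in B2^* psi avoids A3^* for some A3 in x, and finitely many of these A3 would
    intersect in a member of x whose trace on A2 is never hit. *)
Lemma canonical_map_image (A2 B2 : set nat) :
  (forall A3, A3 `<=` A2 -> infinite_set A3 ->
     exists y : star B, star B2 (val y) /\ m (val y) (A3 `&` A) = r) ->
  [set x : star A | star A2 (val x)] `<=` psi @` [set y : star B | star B2 (val y)].
Proof.
move=> hit x xA2; apply: contrapT => nx.
have [||y|E [A3 xA3 A3P] fE] := @Nstar_exhaust (fun E => exists2 A3, star A3 (val x) &
    forall y : star B, star E (val y) -> star B2 (val y) -> m (val y) (A3 `&` A) <> r).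
- by exists setT; [exact: starT|move=> y /star_infinite/(_ (finite_set0 _))].
- move=> E E' [A3 xA3 EP] [A4 xA4 EP']; exists (A3 `&` A4); first exact: starI.
  move=> y yE yB2 yr; have yB : star B (val y) := set_mem (valP y).
  have [yE1|yE1] := (starU _ _ _).1 yE.
    apply: (EP y yE1 yB2); apply: mrS yB _ (@subIsetr _ _ _) yr.
    by apply: setSI; exact: subIsetl.
  apply: (EP' y yE1 yB2); apply: mrS yB _ (@subIsetr _ _ _) yr.
  by apply: setSI; exact: subIsetr.
- have [yBB|/starC nyBB] := pselect (star (B `&` B2) y); last first.
    exists (~` (B `&` B2)) => //; exists setT; first exact: starT.
    move=> z /starC znB zB2; case: znB; apply: starI => //.
    exact: (set_mem (valP z)).
  have yB : star B y by apply: starS yBB; exact: subIsetl.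
  have yB2 : star B2 y by apply: starS yBB; exact: subIsetr.
  pose y' : star B := exist _ y (mem_set yB).
  have [C [xC yC]] : exists C, star C (val x) /\ ~ star C (val (psi y')).
    apply: contrapT => nC; apply: nx; exists y' => //.
    apply/esym/val_inj/Nstar_eq => C xC; apply: contrapT => yC.
    by apply: nC; exists C.
  have [E yE EP] := mloc y' C; exists E => //; exists C => // z /EP -> _ /psiP.
  exact: yC.
have [|y [yB2 yr]] := hit (A3 `&` A2) (@subIsetr _ _ _).
  exact: star_infinite (starI xA3 xA2).
apply: (A3P y) => //.
  exact: star_cofinite.
apply: mrS yr; [exact: (set_mem (valP y))| |exact: subIsetr].
by apply: setSI; exact: subIsetl.
Qed.

End canonical_map.

Lemma extensionE (R : realType) (A : set nat) (f : cspace R (star A)) (x : star A) :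
  extension A f (val x) = f x.
Proof.
by rewrite -[LHS]/('valL_ (0 : R) f (val x)) /valL_ /= oinv_set_val valK.
Qed.

Lemma extension_out (R : realType) (A : set nat) (f : cspace R (star A)) (x : Nstar) :
  ~ star A x -> extension A f x = 0.
Proof.
move=> nAx; rewrite -[LHS]/('valL_ (0 : R) f x) /valL_ /= oinv_set_val insubN//.
by apply/negP => /set_mem.
Qed.

Theorem theorem5p8 (R : realType)
    (T : {linear cspace R Nstar -> cspace R Nstar}) :
  automorphism T -> funnelless T ->
  forall A : set nat, infinite_set A ->
    exists (A1 B : set nat) (psi : star B -> star A1),
      [/\ infinite_set A1, A1 `<=` A, infinite_set B, quasi_open psi &
          canonizable_along (compression T B A1) psi].
Proof.
move=> [Tb [S [TS _ Sb]]] fT A iA; pose m := operator_kernel Tb.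
have [c c0 mc] := operator_kernel_lower Tb TS Sb.
have [A1 [B [r [[A1A iA1 iB r0] [m0r mA1 hit qo]]]]] :=
  pure_pair c0 mc (operator_kernel_vanishes Tb fT) iA.
have [psi psiP] := exists_canonical_map r0 m0r mA1.
have psi_cont := canonical_map_continuous r0 m0r psiP.
exists A1, B, psi; split=> //.
  split=> // U oU [y Uy].
  have /nbhs_star_sub[C yC CU] : nbhs y U by apply: open_nbhs_nbhs.
  have yB : star B (val y) := set_mem (valP y).
  have [A2 [A21 iA2 A2P]] := qo _ (@subIsetl _ B C) (star_infinite (starI yB yC)).
  have [x xA2] := star_nonempty iA2.
  have xA1 : star A1 x := starS A21 xA2.
  exists (exist _ x (mem_set xA1)); apply/nbhs_star_sub; exists A2 => //.
  apply: subset_trans (image_subset psi CU).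
  apply: (canonical_map_image r0 m0r psiP) => A3 A32 iA3.
  have [z zBC mz] := A2P A3 A32 iA3.
  have zB : star B z by apply: starS zBC; exact: subIsetl.
  exists (exist _ z (mem_set zB)); split=> /=.
    by apply: starS zBC; exact: subIsetr.
  by rewrite setIidl//; exact: subset_trans A21.
split=> //.
  apply/seteqP; split=> // x _.
  have [||y _ <-] := @canonical_map_image _ _ _ _ _ r0 m0r _ psiP A1 setT _ x.
  - move=> A3 A31 iA3; have [z zB mz] := hit A3 A31 iA3.
    exists (exist _ z (mem_set zB)); split; first exact: starT.
    by rewrite setIidl.
  - exact: (set_mem (valP x)).
  - by exists y.
exists r => // f y.
have yB : star B (val y) := set_mem (valP y).
rewrite -[LHS]/(T (extension A1 f) (val y)) -(extensionE f (psi y)).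
apply/eqP; rewrite -subr_eq0; apply/eqP.
(* The error functional kills the indicators of subsets of A1. *)
pose l (g : cspace R Nstar) := T g (val y) - r * g (val (psi y)).
apply: (@bounded_functional_eq0 _ l A1).
- move=> a g h; rewrite /l linearP !cspaceDE !cspaceZE; lra.
- have [K TK] := bounded_operator_norm Tb.
  exists (K + `|r|) => g t gt; apply: le_trans (ler_normB _ _) _.
  by rewrite mulrDl lerD//; [exact: TK|rewrite normrM ler_wpM2l].
- move=> C CA1; have [yC|yC] := pselect (star C (val (psi y))).
    rewrite /l indic_starT// mulr1 -[T _ _]/(m (val y) C).
    by have /psiP := yC; rewrite setIidl// => ->; rewrite subrr.
  rewrite /l indic_starF// mulr0 subr0 -[T _ _]/(m (val y) C).
  have [//|mC] := m0r _ _ yB CA1; case: yC; apply/psiP; by rewrite setIidl.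
- by move=> z; exact: extension_out.
Qed.
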